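(* Fix an integer $\Delta\ge 1$. There exist constants $c_\Delta, C_\Delta>0$ (depending only on $\Delta$) such that for every $n\ge 2$ and every connected graph $G$ on $n$ vertices with maximum degree at most $\Delta$, we have $c_\Delta \log n \le A(G) \le C_\Delta \log n$; that is, $A(G)=\Theta_\Delta(\log n)$.
   Context: For a graph $G$, a vertex $u$ and integer $r\ge 0$, the ball $B(u,r)$ is the set of vertices at graph distance at most $r$ from $u$. $A(G)$ denotes the minimum number of queries of the form ''is $v\in B(u,r)$?'' (with $u\in V(G)$ and $r\ge 0$ arbitrary) needed in the worst case to determine an unknown vertex $v\in V(G)$ adaptively, i.e. where each query may depend on the answers to previous queries. *)

(* Defs.v *)
From mathcomp Require Import all_boot all_order all_algebra.
From mathcomp Require Import boolp reals exp.

Set Implicit Arguments.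
Unset Strict Implicit.
Unset Printing Implicit Defensive.

Record sgraph := SGraph {
  vertex :> finType;
  adj : rel vertex;
  adj_sym : symmetric adj;
  adj_irrefl : irreflexive adj }.

Section Graph.
Variable G : sgraph.
Implicit Types (u v w : G) (r k : nat).

Definition connected_graph := forall u v, connect (@adj G) u v.

Definition degree v := #|[set w | adj v w]|.

Definition max_degree := \max_(v : G) degree v.

Definition walk k u v :=
  [exists p : k.-tuple G, path (@adj G) u p && (last u p == v)].

(* The length of a shortest walk.  A shortest walk has fewer than #|G| edges,
   so the search may stop there; the value is #|G| iff u and v are not
   connected, a case that [ball] excludes separately. *)
Definition dist u v := find (fun k => walk k u v) (iota 0 #|G|).

Definition ball u r := [set v | connect (@adj G) u v && (dist u v <= r)].

Lemma ballP u r v :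
  reflect (exists p : seq G,
             [/\ path (@adj G) u p, last u p = v & size p <= r])
          (v \in ball u r).
Proof.
rewrite inE; apply: (iffP andP) => [[/connectP[p0 up0 v_p0] le_r]|].
  have : has (fun k => walk k u v) (iota 0 #|G|).
    move: v_p0; case/shortenP: up0 => p up Up _ ->.
    apply/hasP; exists (size p).
      rewrite mem_iota /= add0n -[_ < _]/(size (u :: p) <= _).
      by rewrite -(card_uniqP Up) max_card.
    by apply/existsP; exists (in_tuple p); rewrite up /=.
  move=> hw; have := nth_find 0 hw; rewrite nth_iota; last first.
    by rewrite -[X in _ < X](size_iota 0) -has_find.
  rewrite add0n => /existsP[p /andP[up /eqP lp]].
  by exists p; rewrite size_tuple.
move=> [p [up lp sp]]; split; first by apply/connectP; exists p.
apply: leq_trans sp; rewrite /dist leqNgt; apply/negP => lt_p.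
have lt_pG : size p < #|G|.
  by apply: leq_trans lt_p _; rewrite -[X in _ <= X](size_iota 0) find_size.
have := before_find 0 lt_p; rewrite nth_iota // add0n => /negbT/existsP[].
by exists (in_tuple p); rewrite up /= lp.
Qed.

Lemma ball0 u : ball u 0 = [set u].
Proof.
apply/setP => v; rewrite in_set1; apply/ballP/eqP => [[[|? ?] []] //|->].
by exists [::].
Qed.

(* An adaptive sequence of queries: [Query u r yes no] asks whether the unknown
   vertex lies in [ball u r] and goes on with [yes] or [no] accordingly. *)
Inductive strategy :=
  | Stop
  | Query (u : G) (r : nat) (yes no : strategy).

Fixpoint answers (s : strategy) v : seq bool :=
  match s with
  | Stop => [::]
  | Query u r yes no =>
      if v \in ball u r then true :: answers yes v else false :: answers no v
  end.

(* The answers received pin down the unknown vertex iff no other vertex yields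
   the same ones. *)
Definition determines (s : strategy) := injective (answers s).

Definition worst_case (s : strategy) := \max_(v : G) size (answers s v).

Definition solvable_in k : bool :=
  `[< exists2 s, determines s & worst_case s = k >].

(* Querying the balls of radius 0 one after the other finds the vertex. *)
Lemma solvable_in_ex : exists k, solvable_in k.
Proof.
pose search := foldr (fun u s => Query u 0 Stop s) Stop.
exists (worst_case (search (enum G))); apply/asboolP.
exists (search (enum G)) => // v w; have : v \in enum G by rewrite mem_enum.
elim: (enum G) => //= u s IHs; rewrite !ball0 !in_set1 inE.
case: eqP => [->|_] /=; first by case: eqP => [->|].
by move=> vs; case: eqP => // _ [] /(IHs vs).
Qed.

Definition query_number := ex_minn solvable_in_ex.

End Graph.

(* Main.v *)
(** Upper bound: let [S] be the set of remaining candidates, [#|S| >= 2], and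
    let [r] be the smallest radius for which some ball of radius [r] contains at
    least a fraction [1 / (Delta + 2)] of [S]. If [r = 0], this ball is a single
    vertex. Otherwise it is covered by at most [Delta + 1] balls of radius
    [r - 1], each with less than that fraction. In both cases it also leaves out
    at least a fraction [1 / (Delta + 2)] of [S], so that every query can shrink
    [S] by a constant factor.

    Lower bound: the sequences of answers to [k] yes/no questions separate at
    most [2 ^ k] vertices. *)

Require Import Defs.
From mathcomp Require Import all_boot all_order all_algebra.
From mathcomp Require Import boolp reals exp.

Import Order.TTheory GRing.Theory Num.Theory.

Section Queries.
Set Implicit Arguments.
Unset Strict Implicit.
Variable G : sgraph.
Implicit Types (u v w : G) (s : strategy G) (S : {set G}).

(** Induction on [s]: the first query splits [S], and each branch has one answer fewer left to
    separate its part. Injectivity is asked on [S] only, since a branch need not separate vertices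
    ruled out earlier. *)
Lemma card_le_answers s S k :
  {in S &, injective (answers s)} ->
  (forall v, v \in S -> size (answers s v) <= k) -> #|S| <= 2 ^ k.
Proof.
elim: s S k => [|u r yes IHyes no IHno] S k injS leS.
  apply: (@leq_trans 1); last by rewrite expn_gt0.
  by apply/card_le1_eqP => x y xS yS; apply: injS.
case: k leS => [|k] leS.
  have [->|[x xS]] := set_0Vmem S; first by rewrite cards0.
  by have := leS x xS; rewrite /=; case: ifP.
rewrite -(cardsID (ball u r) S) expnS mul2n -addnn leq_add //.
- apply: IHyes => [x y|x].
    rewrite !inE => /andP[xS xB] /andP[yS yB] exy; apply: injS => //=.
    by rewrite !inE xB yB exy.
  by rewrite !inE => /andP[xS xB]; have := leS x xS; rewrite /= inE xB.
- apply: IHno => [x y|x].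
    rewrite !inE => /andP[xB xS] /andP[yB yS] exy; apply: injS => //=.
    by rewrite !inE (negPf xB) (negPf yB) exy.
  by rewrite !inE => /andP[xB xS]; have := leS x xS; rewrite /= inE (negPf xB).
Qed.

Lemma card_le_query_number : #|G| <= 2 ^ query_number G.
Proof.
rewrite /query_number; case: ex_minnP => k /asboolP[s inj_s <-] _.
rewrite -cardsT; apply: (@card_le_answers s) => [x y _ _|v _].
  exact: inj_s.
exact: (leq_bigmax (F := fun v => size (answers s v))).
Qed.

(** The first edge of a nonempty walk from [u] leads to a neighbour, from which one edge fewer
    remains. *)
Lemma ball_succ_sub u r :
  ball u r.+1 \subset ball u r :|: \bigcup_(w : G | adj u w) ball w r.
Proof.
apply/subsetP => v /ballP[[|w p] []] /=.
  by move=> _ <- _; apply/setUP; left; apply/ballP; exists [::].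
move=> /andP[uw wp] lp sp; apply/setUP; right; apply/bigcupP; exists w => //.
by apply/ballP; exists p.
Qed.

Lemma ball_card u : connected_graph G -> ball u #|G| = [set: G].
Proof.
move=> connG; apply/setP => v; rewrite !inE connG /=.
by rewrite -[X in _ <= X](size_iota 0) find_size.
Qed.

Lemma card_ball_succ S Delta u r m :
  degree u <= Delta -> (forall w, #|S :&: ball w r| <= m) ->
  #|S :&: ball u r.+1| <= Delta.+1 * m.
Proof.
move=> degu le_m.
apply: leq_trans (subset_leq_card (setIS S (ball_succ_sub u r))) _.
rewrite setIUr; apply: leq_trans (leq_card_setU _ _) _.
rewrite mulSn leq_add // big_distrr /=.
apply: leq_trans (_ : \sum_(w : G | adj u w) #|S :&: ball w r| <= _).
  elim/big_rec2: _ => [|w n A _ leA]; first by rewrite cards0.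
  by apply: leq_trans (leq_card_setU _ _) _; rewrite leq_add2l.
apply: leq_trans (_ : \sum_(w : G | adj u w) m <= _); first exact: leq_sum.
rewrite sum_nat_const leq_mul2r; apply/orP; right.
by apply: leq_trans degu; rewrite /degree cardsE.
Qed.

Lemma balanced_ball S Delta :
  connected_graph G -> max_degree G <= Delta -> 1 < #|S| ->
  exists u r, #|S| <= Delta.+2 * #|S :&: ball u r| /\
              #|S| <= Delta.+2 * #|S :\: ball u r|.
Proof.
move=> connG degG S_gt1.
pose big r := [exists u, #|S| <= Delta.+2 * #|S :&: ball u r|].
have ex_big : exists r, big r.
  have /card_gt0P[u _] : 0 < #|S| by apply: ltnW.
  by exists #|G|; apply/existsP; exists u; rewrite ball_card // setIT leq_pmull.
have [r /existsP[u le_in] min_r] := ex_minnP ex_big.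
exists u, r; split => //.
(* The part left out is large iff the part inside is at most [Delta.+1 / Delta.+2] of [S]. *)
suff le_cap : Delta.+2 * #|S :&: ball u r| <= Delta.+1 * #|S|.
  rewrite -(leq_add2l (Delta.+2 * #|S :&: ball u r|)) -mulnDr cardsID.
  by rewrite [X in _ <= X]mulSn [X in _ <= X]addnC leq_add2r.
case: r le_in min_r => [|r] le_in min_r.
  apply: (@leq_trans (Delta.+2 * 1)).
    rewrite leq_mul2l ball0; apply/orP; right.
    by rewrite -(cards1 u) subset_leq_card // subsetIr.
  apply: (@leq_trans (Delta.+1 * 2)); last by rewrite leq_mul2l.
  by rewrite muln1 muln2 -addnn addSn ltnS addnS ltnS leq_addr.
have small w : Delta.+2 * #|S :&: ball w r| <= #|S|.
  rewrite leqNgt; apply/negP => /ltnW le_w.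
  suff: r < r by rewrite ltnn.
  by apply: min_r; apply/existsP; exists w.
have degu : degree u <= Delta.
  exact: leq_trans (leq_bigmax (F := @degree G) u) degG.
(* Cardinals are integers, so the bound may be rounded down to the form [card_ball_succ] takes. *)
have small' w : #|S :&: ball w r| <= #|S| %/ Delta.+2.
  by rewrite leq_divRL // mulnC.
apply: leq_trans (leq_mul (leqnn _) (card_ball_succ degu small')) _.
by rewrite mulnCA leq_mul2l mulnC leq_trunc_div orbT.
Qed.

(** The numerical hypothesis says, free of division, that [k] reductions by the factor
    [Delta.+1 / Delta.+2] leave fewer than two candidates. *)
Lemma strategy_upto S Delta k :
  connected_graph G -> max_degree G <= Delta ->
  Delta.+1 ^ k * #|S| < 2 * Delta.+2 ^ k ->
  exists2 s, {in S &, injective (answers s)} &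
             forall v, size (answers s v) <= k.
Proof.
move=> connG degG; elim: k S => [|k IHk] S ltS.
  exists (Stop G) => // x y xS yS _.
  move: ltS; rewrite !expn0 mul1n muln1 ltnS => /card_le1_eqP; exact.
have [S_le1|S_gt1] := leqP #|S| 1.
  exists (Stop G) => // x y xS yS _; move/card_le1_eqP: S_le1; exact.
have [u [r [le_in le_out]]] := balanced_ball connG degG S_gt1.
(* [A] is the part kept after an answer and [B] the part discarded. *)
have shrink A B : #|A| + #|B| = #|S| -> #|S| <= Delta.+2 * #|B| ->
    Delta.+1 ^ k * #|A| < 2 * Delta.+2 ^ k.
  move=> AB leB; rewrite -(ltn_pmul2l (ltn0Sn Delta.+1)) mulnCA.
  rewrite [X in _ < X]mulnCA -expnS; apply: leq_ltn_trans ltS.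
  rewrite expnSr -mulnA leq_mul2l; apply/orP; right.
  by rewrite -(leq_add2r (Delta.+2 * #|B|)) -mulnDr AB mulSn addnC leq_add2l.
have [|yes inj_yes size_yes] := IHk (S :&: ball u r).
  by apply: shrink le_out; rewrite cardsID.
have [|no inj_no size_no] := IHk (S :\: ball u r).
  by apply: shrink le_in; rewrite addnC cardsID.
exists (Query u r yes no) => [x y xS yS|v] /=; last first.
  by case: ifP => _; rewrite ltnS.
case: ifP => xB; case: ifP => yB // [] /=.
- by apply: inj_yes; rewrite inE ?xS ?yS.
- by apply: inj_no; rewrite inE ?xB ?yB ?xS ?yS.
Qed.

Lemma query_number_le Delta :
  connected_graph G -> max_degree G <= Delta -> 0 < #|G| ->
  query_number G <= Delta.+1 * trunc_log 2 #|G|.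
Proof.
move=> connG degG G_gt0; set L := trunc_log 2 #|G|.
(* Bernoulli: [(1 + 1 / (Delta + 1)) ^ (Delta + 1) >= 2] *)
have two_le : 2 * Delta.+1 ^ Delta.+1 <= Delta.+2 ^ Delta.+1.
  rewrite -[Delta.+2]addn1 expnDn big_ord_recl big_ord_recl /= /bump /=.
  rewrite addnA mul2n -addnn !exp1n !muln1 bin0 bin1 mul1n subn0 subSS subn0.
  by rewrite -expnS leq_addr.
(* By [two_le], each of [L] blocks of [Delta.+1] queries at least halves the candidates, of which
   there are fewer than [2 ^ L.+1]. *)
have ltG :
    Delta.+1 ^ (Delta.+1 * L) * #|[set: G]| < 2 * Delta.+2 ^ (Delta.+1 * L).
  rewrite cardsT; apply: (@leq_trans (Delta.+1 ^ (Delta.+1 * L) * 2 ^ L.+1)).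
    by rewrite ltn_pmul2l ?expn_gt0 //; apply: trunc_log_ltn.
  rewrite expnS mulnCA leq_mul2l /= !expnM -expnMn mulnC.
  by case: (L) => [|l]; rewrite ?expn0 ?leq_exp2r.
have [s inj_s size_s] := strategy_upto connG degG ltG.
rewrite /query_number; case: ex_minnP => m _ min_m.
apply: (@leq_trans (worst_case s)); last by apply/bigmax_leqP.
apply: min_m; apply/asboolP; exists s => // x y.
by apply: inj_s; rewrite inE.
Qed.

End Queries.

Local Open Scope ring_scope.

Theorem theorem1p2 (R : realType) (Delta : nat) (hDelta : (1 <= Delta)%N) :
  exists c C : R,
    [/\ 0 < c, 0 < C &
      forall (n : nat) (G : sgraph),
        (2 <= n)%N -> #|G| = n -> connected_graph G ->
        (max_degree G <= Delta)%N ->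
        c * ln n%:R <= (query_number G)%:R <= C * ln n%:R].
Proof.
have ln2_gt0 : 0 < ln 2%:R :> R by rewrite exp.ln_gt0 // ltr1n.
(* Both constants convert [ln] to base 2; [Delta.+1] is the factor in [query_number_le]. *)
exists (ln 2%:R)^-1, (Delta.+1%:R / ln 2%:R); split.
- by rewrite invr_gt0.
- by rewrite divr_gt0.
move=> n G n_ge2 cardG connG degG; have n_gt0 : (0 < n)%N by apply: ltnW.
have ln_le (a b : nat) : (0 < a)%N -> (a <= b)%N -> ln a%:R <= ln b%:R :> R.
  by move=> a0 ab; rewrite ler_ln ?posrE ?ltr0n ?ler_nat // (leq_trans a0).
have ln_pow k : ln (2 ^ k)%:R = ln 2%:R * k%:R :> R.
  by rewrite natrX lnXn ?ltr0n // mulr_natr.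
apply/andP; split.
  rewrite ler_pdivrMl // -ln_pow; apply: ln_le => //.
  by rewrite -cardG card_le_query_number.
rewrite -mulrA; apply: (@le_trans _ _ (Delta.+1%:R * (trunc_log 2 n)%:R)).
  by rewrite -natrM ler_nat -cardG query_number_le // cardG.
rewrite ler_pM2l ?ltr0n // ler_pdivlMl // -ln_pow; apply: ln_le.
  by rewrite expn_gt0.
exact: trunc_logP.
Qed.
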